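(* Let $A \in \mathbb{C}^{n \times n}$ be a Hermitian matrix such that $A_{jj}=0$ for $j=1,\dots,n$, and let $V \in \mathbb{R}^{n\times n}$ be a diagonal matrix. Then $A+V$ and $A$ are isospectral if and only if $V=0$.
   Context: Two Hermitian matrices in $\mathbb{C}^{n\times n}$ are called isospectral if and only if they have the same eigenvalues, counted with multiplicities. *)

(* Defs.v *)
From HB Require Import structures.
From mathcomp Require Import all_boot all_order all_algebra.
From mathcomp Require Import reals complex.

Set Implicit Arguments.
Unset Strict Implicit.
Unset Printing Implicit Defensive.

Import Order.TTheory GRing.Theory Num.Theory.
Local Open Scope ring_scope.

(* Algebraic multiplicity; for a Hermitian matrix it coincides with the
   dimension of the eigenspace.  It is 0 when a is not an eigenvalue. *)
Definition eigenvalue_mult (C : numClosedFieldType) (n : nat)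
  (A : 'M[C]_n) (a : C) : nat := mup a (char_poly A).

Lemma eigenvalue_mult_gt0 (C : numClosedFieldType) (n : nat)
  (A : 'M[C]_n) (a : C) : (0 < eigenvalue_mult A a)%N = eigenvalue A a.
Proof.
by rewrite /eigenvalue_mult -XsubC_dvd ?monic_neq0 ?char_poly_monic //
  eigenvalue_root_char dvdp_XsubCl.
Qed.

(* By eigenvalue_mult_gt0, equality of all multiplicities includes equality of
   the sets of eigenvalues. *)
Definition isospectral (C : numClosedFieldType) (n : nat) (A B : 'M[C]_n) :
  Prop := forall a : C, eigenvalue_mult A a = eigenvalue_mult B a.

(* Main.v *)
Require Import Defs.
From HB Require Import structures.
From mathcomp Require Import all_boot all_order all_algebra.
From mathcomp Require Import reals complex.

(** The trace of the square of a matrix is the sum of the squares of its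
    eigenvalues, hence an isospectral invariant ([isospectral_trace_sqr]).
    Expanding the square,
      tr (A + V)^2 = tr A^2 + 2 tr (A V) + tr V^2,
    and tr (A V) = 0 because V is diagonal while A vanishes on the diagonal
    ([mxtrace_sqrD_diag]).  Isospectrality of A + V and A thus forces
    tr V^2 = 0; this is the sum of the squares of the diagonal entries of V,
    and these entries are real, so that they all vanish. *)

Set Implicit Arguments.
Unset Strict Implicit.
Unset Printing Implicit Defensive.

Import Order.TTheory GRing.Theory Num.Theory.
Local Open Scope ring_scope.

Lemma char_poly_conj (F : fieldType) (n : nat) (P A : 'M[F]_n) :
  P \in unitmx -> char_poly (P *m A *m invmx P) = char_poly A.
Proof.
move=> Pu; pose Q := map_mx polyC P; pose Q' := map_mx polyC (invmx P).
have QQ' : Q *m Q' = 1%:M by rewrite -map_mxM mulmxV ?map_mx1.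
rewrite /char_poly.
have -> : char_poly_mx (P *m A *m invmx P) = Q *m char_poly_mx A *m Q'.
  rewrite /char_poly_mx mulmxBr mulmxBl !map_mxM.
  by rewrite scalar_mxC -(mulmxA _ Q) QQ' mulmx1.
by rewrite !det_mulmx mulrAC -det_mulmx QQ' det1 mul1r.
Qed.

Lemma mxtrace_sqr_trig (R : comNzRingType) (n : nat) (T : 'M[R]_n) :
  is_trig_mx T -> \tr (T *m T) = \sum_i T i i ^+ 2.
Proof.
move=> /is_trig_mxP Ttrig; apply: eq_bigr => i _; rewrite mxE (bigD1 i) //=.
rewrite big1 ?addr0 ?expr2 // => j ji.
have [lt_ij|lt_ji|/val_inj eq_ij] := ltngtP i j.
- by rewrite (Ttrig i j lt_ij) mul0r.
- by rewrite (Ttrig j i lt_ji) mulr0.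
- by rewrite eq_ij eqxx in ji.
Qed.

(** A Schur triangularization exhibits the eigenvalues on a diagonal, where
    both the characteristic polynomial and the trace of the square read them
    off. *)
Lemma char_poly_roots_trace_sqr (C : numClosedFieldType) (n : nat)
  (A : 'M[C]_n) :
  exists2 s : seq C, char_poly A = \prod_(x <- s) ('X - x%:P)
                   & \tr (A *m A) = \sum_(x <- s) x ^+ 2.
Proof.
case: n A => [|n] A.
  exists [::]; rewrite big_nil; first by rewrite /char_poly det_mx00.
  by rewrite /mxtrace big_ord0.
have [P /unitarymx_unit Pu] := Schur A isT.
rewrite /similar_to /= conjumx // => Ttrig.
set T := P *m A *m invmx P in Ttrig.
exists [seq T i i | i <- enum 'I_n.+1]; rewrite big_map big_enum /=.
  by rewrite -(char_poly_conj A Pu) char_poly_trig.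
rewrite -mxtrace_sqr_trig // /T -!mulmxA mulKmx // [RHS]mxtrace_mulC.
by rewrite -!mulmxA mulVmx // mulmx1.
Qed.

Lemma isospectral_trace_sqr (C : numClosedFieldType) (n : nat)
  (A B : 'M[C]_n) : isospectral A B -> \tr (A *m A) = \tr (B *m B).
Proof.
move=> isoAB.
have [s charA ->] := char_poly_roots_trace_sqr A.
have [t charB ->] := char_poly_roots_trace_sqr B.
apply: perm_big; apply/allP => x _ /=.
by have := isoAB x; rewrite /eigenvalue_mult charA charB !mu_prod_XsubC => ->.
Qed.

(** As V is diagonal, the cross terms tr (A V) + tr (V A) amount to
    2 \sum_i A i i * V i i, in which only the diagonal of A occurs. *)
Lemma mxtrace_sqrD_diag (R : comNzRingType) (n : nat) (A V : 'M[R]_n) :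
  (forall i, A i i = 0) -> is_diag_mx V ->
  \tr ((A + V) *m (A + V)) = \tr (A *m A) + \sum_i V i i ^+ 2.
Proof.
move=> A0 Vdiag; have /is_diag_mxP V0 := Vdiag.
have Vtrig := is_diag_mx_is_trig Vdiag.
have trAV : \tr (A *m V) = 0.
  rewrite /mxtrace big1 // => i _; rewrite mxE big1 // => j _.
  have [->|ji] := eqVneq j i; first by rewrite A0 mul0r.
  by rewrite V0 ?mulr0.
rewrite mulmxDl !mulmxDr !mxtraceD (mxtrace_mulC V A) trAV addr0 add0r.
by rewrite (mxtrace_sqr_trig Vtrig).
Qed.

Theorem theorem9 (R : realType) (n : nat) (A : 'M[R[i]]_n) (V : 'M[R]_n)
  (hA : A \is hermsymmx) (hA0 : forall j : 'I_n, A j j = 0)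
  (hV : is_diag_mx V) :
  isospectral (A + map_mx (real_complex R) V) A <-> V = 0.
Proof.
split=> [/isospectral_trace_sqr|->]; last by rewrite map_mx0 addr0.
have /is_diag_mxP V0 := hV.
have VCdiag : is_diag_mx (map_mx (real_complex R) V).
  by apply/is_diag_mxP => i j ij; rewrite mxE V0 ?rmorph0.
rewrite mxtrace_sqrD_diag // => /(canRL (addKr _)); rewrite addNr => sum0.
(* The sum vanishes over the complex numbers; positivity of the squares needs
   it over the reals. *)
have {}sum0 : \sum_i V i i ^+ 2 = 0.
  apply: (fmorph_inj (real_complex R)); rewrite rmorph_sum rmorph0 -[RHS]sum0.
  by apply: eq_bigr => i _; rewrite mxE rmorphXn.
apply/matrixP => i j; rewrite mxE.
have [->|ij] := eqVneq i j; last exact: V0.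
apply/eqP; rewrite -sqrf_eq0; apply/eqP.
by apply: (psumr_eq0P _ sum0) => // k _; exact: sqr_ge0.
Qed.
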